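(* Let $(\mathcal{A}_i)_{i\in I}$ be a family of relational structures whose universes are given by unary predicates $P_i$, $i\in I$, and let $\mathcal{A}_P={\rm Comb}_P(\mathcal{A}_i)_{i\in I}$ be their $P$-combination. If the predicates $P_i$ are pairwise disjoint, the languages $\Sigma(\mathcal{A}_i)$, $i\in I$, are at most countable, $|I|\leq\omega$, and the structure $\mathcal{A}_P$ is infinite, then the theory ${\rm Th}(\mathcal{A}_P)$ is $\omega$-categorical if and only if $I$ is finite and each structure $\mathcal{A}_i$ is either finite or $\omega$-categorical.
   Context: All languages are relational. Let $P=(P_i)_{i\in I}$ be a family of nonempty unary predicates and $(\mathcal{A}_i)_{i\in I}$ a family of structures such that $P_i$ is the universe of $\mathcal{A}_i$ and the symbols $P_i$ do not belong to the languages $\Sigma(\mathcal{A}_j)$, $j\in I$. The $P$-union $\mathcal{A}_P$ is the union $\bigcup_{i\in I}\mathcal{A}_i$ (universe: union of the universes; each relation symbol interpreted by the union of its interpretations in the $\mathcal{A}_i$, where a symbol missing from $\Sigma(\mathcal{A}_i)$ is interpreted in $\mathcal{A}_i$ by the empty relation), expanded by the predicates $P_i$. It is called the $P$-combination ${\rm Comb}_P(\mathcal{A}_i)_{i\in I}$ if $\mathcal{A}_i=(\mathcal{A}_P\upharpoonright A_i)\upharpoonright\Sigma(\mathcal{A}_i)$ for all $i\in I$, where $A_i$ is the universe of $\mathcal{A}_i$. An infinite structure is called $\omega$-categorical if its theory is. *)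

(* Defs.v *)
From mathcomp Require Import all_boot.
From mathcomp Require Import boolp classical_sets functions cardinality.

Set Implicit Arguments.
Unset Strict Implicit.
Unset Printing Implicit Defensive.

Local Open Scope classical_set_scope.
Local Open Scope card_scope.

Record language := Language { symbol :> Type; arity : symbol -> nat }.

Definition interpretation (L : language) (M : Type) :=
  forall s : L, set ((arity s).-tuple M).

Record structure (L : language) := Structure {
  universe :> Type;
  interp : interpretation L universe }.

Arguments interp {L} M s t : rename.

(* Variables are natural numbers; the remaining connectives and the existential
   quantifier are definable, satisfaction being classical. *)
Inductive formula (L : language) :=
| Eq of nat & nat
| Rel (s : L) of (arity s).-tuple nat
| Bot
| Imp of formula L & formula L
| All of nat & formula L.

Arguments Eq {L} x y : rename.
Arguments Rel {L} s t : rename.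
Arguments Bot {L}.

Fixpoint free_vars (L : language) (phi : formula L) : seq nat :=
  match phi with
  | Eq x y => [:: x; y]
  | Rel _ t => t
  | Bot => [::]
  | Imp phi1 phi2 => free_vars phi1 ++ free_vars phi2
  | All x phi1 => [seq y <- free_vars phi1 | y != x]
  end.

Definition sentence (L : language) (phi : formula L) : Prop :=
  free_vars phi = [::].

Fixpoint sat (L : language) (M : structure L) (e : nat -> M)
    (phi : formula L) : Prop :=
  match phi with
  | Eq x y => e x = e y
  | Rel s t => interp M s (map_tuple e t)
  | Bot => False
  | Imp phi1 phi2 => sat e phi1 -> sat e phi2
  | All x phi1 => forall a : M, sat (fun y => if y == x then a else e y) phi1
  end.

Definition holds (L : language) (M : structure L) (phi : formula L) : Prop :=
  forall e : nat -> M, sat e phi.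

Definition Th (L : language) (M : structure L) : set (formula L) :=
  [set phi | sentence phi /\ holds M phi].

Definition model (L : language) (T : set (formula L)) (M : structure L) : Prop :=
  forall phi, T phi -> holds M phi.

Definition isomorphic (L : language) (M N : structure L) : Prop :=
  exists2 f : M -> N, bijective f &
    forall (s : L) (t : (arity s).-tuple M),
      interp M s t <-> interp N s (map_tuple f t).

Definition infinite (L : language) (M : structure L) : Prop :=
  infinite_set [set: M].

Definition finite (L : language) (M : structure L) : Prop :=
  finite_set [set: M].

Definition denumerable (L : language) (M : structure L) : Prop :=
  [set: M] #= [set: nat].

(* exactly one model of cardinality omega, up to isomorphism *)
Definition omega_categorical (L : language) (T : set (formula L)) : Prop :=
  (exists2 M : structure L, model T M & denumerable M) /\
  (forall M N : structure L, model T M -> model T N ->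
     denumerable M -> denumerable N -> isomorphic M N).

Definition omega_categorical_structure (L : language) (M : structure L) : Prop :=
  infinite M /\ omega_categorical (Th M).

(* The languages of the structures A_i may share symbols, so they are taken as
   subsets Sigma i of a common vocabulary V; likewise the universes, which may
   overlap in general, are subsets P i of a common type U. *)
Definition sublanguage (V : language) (S : set V) : language :=
  Language (fun s : S => arity (val s)).

Definition bigcup_incl (I T : Type) (F : I -> set T) (i : I) (x : F i) :
    \bigcup_j F j :=
  exist _ (val x) (mem_set (ex_intro2 _ _ i Logic.I (set_mem (valP x)))).

(* The predicate symbols P_i are the right summands, hence automatically
   pairwise distinct and outside all the Sigma j. *)
Definition union_language (V : language) (I : Type) (Sigma : I -> set V) :
    language :=
  @Language (set_type (\bigcup_i Sigma i) + I)
    (fun s => match s with inl s => arity (val s) | inr _ => 1 end).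

Definition P_union_interp (V : language) (I U : Type) (Sigma : I -> set V)
    (P : I -> set U)
    (A : forall i, interpretation (sublanguage (Sigma i)) (P i)) :
    interpretation (union_language Sigma) (\bigcup_i P i) :=
  fun s => match s return set ((arity (s : union_language Sigma)).-tuple _) with
  | inl s => [set t | exists (i : I) (si : val s \in Sigma i)
        (u : (arity (val s)).-tuple (P i)),
        A i (exist _ (val s) si) u /\ t = map_tuple (@bigcup_incl I U P i) u]
  | inr i => [set t | P i (val (thead t))]
  end.

Definition P_union (V : language) (I U : Type) (Sigma : I -> set V)
    (P : I -> set U)
    (A : forall i, interpretation (sublanguage (Sigma i)) (P i)) :
    structure (union_language Sigma) :=
  Structure (P_union_interp A).

(* the interpretation, on P i, of the structure (A_P restricted to P i) reduced
   to the language Sigma i *)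
Definition P_union_restriction (V : language) (I U : Type)
    (Sigma : I -> set V) (P : I -> set U)
    (A : forall i, interpretation (sublanguage (Sigma i)) (P i)) (i : I) :
    interpretation (sublanguage (Sigma i)) (P i) :=
  fun s => [set t | interp (P_union A) (inl (bigcup_incl s))
                      (map_tuple (@bigcup_incl I U P i) t)].

Definition is_P_combination (V : language) (I U : Type)
    (Sigma : I -> set V) (P : I -> set U)
    (A : forall i, interpretation (sublanguage (Sigma i)) (P i)) : Prop :=
  forall i, A i = @P_union_restriction V I U Sigma P A i.

(* Main.v *)
Require Import Defs.
From mathcomp Require Import all_boot.
From mathcomp Require Import boolp classical_sets functions cardinality filter.

Set Implicit Arguments.
Unset Strict Implicit.
Unset Printing Implicit Defensive.

Local Open Scope classical_set_scope.

(** Both directions rest on first-order properties that every model of the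
    theory of a P-combination [A_P] inherits.  No element lies on two of the
    predicates; for every index [i], a related tuple lies either inside the part
    on [i], and then its symbol belongs to [Sigma i], or outside of it; and the
    part on [i] is a model of [Th (A i)], by relativizing quantifiers
    ([parted_model], [model_part]).

    If [I] is finite, it can also be expressed that the parts cover the universe.
    A denumerable model is then the disjoint union of countable models of the
    [Th (A i)], each determined up to isomorphism: by categoricity when [A i] is
    infinite, and because a finite structure is determined by its theory
    otherwise ([finite_model_isomorphic]).  Isomorphisms of the parts glue
    ([glue_isomorphisms]).  A denumerable model exists by the downward
    Loewenheim-Skolem theorem ([countable_elementary_hull]).

    Conversely, let [Th A_P] be omega-categorical.  Were [I] infinite, a countable
    elementary substructure of [A_P] would be covered by its parts, while an
    ultrapower of [A_P] has an element outside all the parts, hence so has a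
    suitable countable elementary substructure of the ultrapower
    ([limit_element], [omega_categorical_finite_index]).  If [A i] is infinite,
    the part on [i] of a denumerable model [N] of [Th A_P] is a denumerable model
    of [Th (A i)].  Any two denumerable models [X] and [Y] of [Th (A i)] can be
    substituted for that part; by a Feferman-Vaught argument
    ([splice_reduction]) the theory does not change, so the results are
    isomorphic, and an isomorphism between them respects the predicate of [i] and
    restricts to an isomorphism of [X] and [Y]
    ([omega_categorical_part]). *)

(** * Satisfaction and theories *)

Notation upd e x a := (fun y => if y == x then a else e y) (only parsing).

Lemma sat_eq_free (L : language) (M : structure L) (phi : formula L)
    (e e' : nat -> M) :
  (forall y, y \in free_vars phi -> e y = e' y) -> sat e phi <-> sat e' phi.
Proof.
elim: phi e e' => [x y|s t||p IHp q IHq|x p IHp] e e' ee' /=.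
- by rewrite !ee' ?inE ?eqxx ?orbT.
- suff -> : map_tuple e t = map_tuple e' t by [].
  by apply: val_inj => /=; apply/eq_in_map.
- by [].
- rewrite (IHp e e') ?(IHq e e') // => y yp; apply: ee';
    by rewrite /= mem_cat yp ?orbT.
- have H a : sat (upd e x a) p <-> sat (upd e' x a) p.
    apply: IHp => y yp; case: eqP => // /eqP yx.
    by apply: ee'; rewrite /= mem_filter yx.
  by split=> h a; apply/H.
Qed.

Lemma sat_ext (L : language) (M : structure L) (phi : formula L)
    (e e' : nat -> M) : e =1 e' -> sat e phi <-> sat e' phi.
Proof. by move=> ee'; apply: sat_eq_free => y _. Qed.

Lemma sentence_sat (L : language) (M : structure L) (phi : formula L)
    (e e' : nat -> M) : sentence phi -> sat e phi <-> sat e' phi.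
Proof. by move=> sphi; apply: sat_eq_free => y; rewrite sphi. Qed.

Lemma sentence_holds (L : language) (M : structure L) (phi : formula L)
    (e : nat -> M) : sentence phi -> sat e phi -> holds M phi.
Proof. by move=> sphi h e'; apply/(sentence_sat e' e sphi). Qed.

Definition univ_closure (L : language) (phi : formula L) : formula L :=
  foldr (@All L) phi (free_vars phi).

Lemma sentence_univ_closure (L : language) (phi : formula L) :
  sentence (univ_closure phi).
Proof.
have fvE s : free_vars (foldr (@All L) phi s)
    = [seq y <- free_vars phi | y \notin s].
  elim: s => [|x s IHs] /=; first by rewrite filter_predT.
  by rewrite IHs -filter_predI; apply: eq_filter => y /=; rewrite inE negb_or.
rewrite /sentence /univ_closure fvE -[RHS](filter_pred0 (free_vars phi)).
by apply: eq_in_filter => y ->.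
Qed.

Lemma holds_All (L : language) (M : structure L) (x : nat) (phi : formula L) :
  holds M (All x phi) <-> holds M phi.
Proof.
split=> h e; last by move=> a; apply: h.
have := h e (e x); apply: (iffLR (sat_ext _ _)) => y.
by case: eqP => // ->.
Qed.

Lemma holds_univ_closure (L : language) (M : structure L) (phi : formula L) :
  holds M (univ_closure phi) <-> holds M phi.
Proof.
rewrite /univ_closure; elim: (free_vars phi) => //= x s IHs.
exact: iff_trans (holds_All _ _ _) IHs.
Qed.

(** Validity of an open formula is validity of its universal closure, so models
    of a theory can be handled without ever binding variables. *)
Lemma model_Th_holds (L : language) (M N : structure L) (phi : formula L) :
  model (Th M) N -> holds M phi -> holds N phi.
Proof.
move=> MN Mphi; apply/holds_univ_closure/MN; split.
  exact: sentence_univ_closure.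
exact/holds_univ_closure.
Qed.

(** The theory of a nonempty structure is complete. *)
Lemma model_Th_sat (L : language) (M N : structure L) (phi : formula L)
    (eM : nat -> M) (eN : nat -> N) :
  model (Th M) N -> sentence phi -> sat eM phi <-> sat eN phi.
Proof.
move=> MN sphi; split => [h|h].
  by apply: (MN phi); split=> //; apply: sentence_holds h.
apply: contrapT => nh.
suff : holds N (Imp phi Bot) by move=> /(_ eN); apply.
apply: (model_Th_holds MN) => e /= he.
by apply: nh; apply/(sentence_sat _ e).
Qed.

Lemma model_Th_trans (L : language) (M N K : structure L) :
  model (Th M) N -> model (Th N) K -> model (Th M) K.
Proof. by move=> MN NK phi Mphi; apply: NK; split; [case: Mphi|apply: MN]. Qed.

Definition Neg (L : language) (p : formula L) : formula L := Imp p Bot.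
Definition And (L : language) (p q : formula L) : formula L :=
  Neg (Imp p (Neg q)).
Definition Ex (L : language) (x : nat) (p : formula L) : formula L :=
  Neg (All x (Neg p)).
Definition BigAnd (L : language) (T : Type) (F : T -> formula L) (l : seq T) :
    formula L :=
  foldr (fun i p => And (F i) p) (Neg Bot) l.
Definition BigOr (L : language) (T : Type) (F : T -> formula L) (l : seq T) :
    formula L :=
  Neg (BigAnd (fun i => Neg (F i)) l).

Lemma sat_And (L : language) (M : structure L) (e : nat -> M)
    (p q : formula L) : sat e (And p q) <-> sat e p /\ sat e q.
Proof.
split=> [/= h|[hp hq] /= /(_ hp)]; last exact.
by split; apply: contrapT => n; apply: h => // hp hq; apply: n.
Qed.

Lemma sat_Ex (L : language) (M : structure L) (e : nat -> M) (x : nat)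
    (p : formula L) : sat e (Ex x p) <-> exists a, sat (upd e x a) p.
Proof.
split=> [/= h|[a ha] /= /(_ a)]; last exact.
by apply: contrapT => n; apply: h => a ha; apply: n; exists a.
Qed.

Lemma sat_BigAnd (L : language) (M : structure L) (e : nat -> M) (T : eqType)
    (F : T -> formula L) (l : seq T) :
  sat e (BigAnd F l) <-> forall i, i \in l -> sat e (F i).
Proof.
elim: l => [|j l IHl]; first by split=> // _ [].
rewrite [BigAnd _ _]/=; split=> [/sat_And[hj /IHl hl] i|h].
  by rewrite inE => /orP[/eqP->//|/hl].
apply/sat_And; split; first by apply: h; rewrite inE eqxx.
by apply/IHl => i il; apply: h; rewrite inE il orbT.
Qed.

Lemma sat_BigOr (L : language) (M : structure L) (e : nat -> M) (T : eqType)
    (F : T -> formula L) (l : seq T) :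
  sat e (BigOr F l) <-> exists2 i, i \in l & sat e (F i).
Proof.
split=> [h|[i il hi] /(sat_BigAnd _ _ _)/(_ i il)]; last exact.
apply: contrapT => n; apply: h; apply/sat_BigAnd => i il hi.
by apply: n; exists i.
Qed.

Lemma free_vars_BigAnd (L : language) (T : eqType) (F : T -> formula L)
    (l : seq T) (y : nat) :
  y \in free_vars (BigAnd F l) -> exists2 i, i \in l & y \in free_vars (F i).
Proof.
elim: l => //= j l IHl; rewrite !mem_cat !orbF => /orP[yj|/IHl[i il yi]].
  by exists j; rewrite ?inE ?eqxx.
by exists i; rewrite ?inE ?il ?orbT.
Qed.

(** * Elementary maps *)

(** An isomorphism and the inclusion of a Skolem hull are both instances: the
    last hypothesis asks for counterexamples in the image only. *)
Lemma tarski_vaught (L : language) (M N : structure L) (f : M -> N) :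
  injective f ->
  (forall (s : L) (t : (arity s).-tuple M),
     interp M s t <-> interp N s (map_tuple f t)) ->
  (forall (e : nat -> M) x phi b, ~ sat (upd (f \o e) x b) phi ->
     exists a, ~ sat (upd (f \o e) x (f a)) phi) ->
  forall phi (e : nat -> M), sat e phi <-> sat (f \o e) phi.
Proof.
move=> f_inj f_rel f_tv.
elim=> [x y|s t||p IHp q IHq|x p IHp] e //=.
- by split=> [->|/f_inj].
- rewrite f_rel; suff -> : map_tuple f (map_tuple e t) = map_tuple (f \o e) t.
    by [].
  by apply: val_inj; rewrite /= -map_comp.
- by rewrite (iff_trans (IHp e) (iff_refl _)) IHq.
- have E a : sat (upd e x a) p <-> sat (upd (f \o e) x (f a)) p.
    apply: iff_trans (IHp _) _; apply: sat_ext => y /=.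
    by case: eqP.
  split=> [h b|h a]; last exact/E.
  apply: contrapT => /f_tv[a]; apply; exact/E.
Qed.

Lemma isomorphic_holds (L : language) (M N : structure L) (phi : formula L) :
  isomorphic M N -> holds M phi <-> holds N phi.
Proof.
move=> [f [g fK gK] f_rel].
have E : forall (e : nat -> M), sat e phi <-> sat (f \o e) phi.
  apply: tarski_vaught => //; first exact: can_inj fK.
  by move=> e x psi b n; exists (g b); rewrite gK.
split=> h e; last exact/E.
apply/(@sat_ext _ _ _ (f \o (g \o e))); last exact/E.
by move=> y /=; rewrite gK.
Qed.

Lemma isomorphic_model (L : language) (M N : structure L) :
  isomorphic M N -> model (Th M) N.
Proof. by move=> MN phi [_ h]; apply/(isomorphic_holds _ MN). Qed.

Lemma isomorphic_sym (L : language) (M N : structure L) :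
  isomorphic M N -> isomorphic N M.
Proof.
move=> [f [g fK gK] f_rel]; exists g; first by exists f.
move=> s t; rewrite f_rel.
suff -> : map_tuple f (map_tuple g t) = t by [].
by apply: val_inj; rewrite /= -map_comp (eq_map gK) map_id.
Qed.

Lemma isomorphic_trans (L : language) (M N K : structure L) :
  isomorphic M N -> isomorphic N K -> isomorphic M K.
Proof.
move=> [f f_bij f_rel] [g g_bij g_rel]; exists (g \o f).
  exact: bij_comp.
move=> s t; rewrite f_rel g_rel.
suff -> : map_tuple g (map_tuple f t) = map_tuple (g \o f) t by [].
by apply: val_inj; rewrite /= -map_comp.
Qed.

(** * Countability *)

Lemma countable_inj (T : Type) :
  countable [set: T] <-> exists f : T -> nat, injective f.
Proof.
split=> [/countable_injP[f f_inj]|[f f_inj]].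
  by exists f => x y; apply: f_inj; rewrite ?in_setT.
by apply/countable_injP; exists f => x y _ _; apply: f_inj.
Qed.

Lemma countable_preimage (T T' : Type) (f : T -> T') :
  injective f -> countable [set: T'] -> countable [set: T].
Proof.
move=> f_inj /countable_inj[g g_inj]; apply/countable_inj.
by exists (g \o f); apply: inj_comp.
Qed.

Lemma infinite_inj (T : Type) :
  infinite_set [set: T] <-> exists f : nat -> T, injective f.
Proof.
split=> [/infiniteP/card_leP/injfunPex[f _ f_inj]|[f f_inj]].
  exists (fun n => val (f (exist _ n (mem_set I)))) => x y /val_inj xy.
  by have [] := f_inj _ _ (mem_set I) (mem_set I) xy.
apply/infiniteP/card_leP/injfunPex.
exists (fun n => exist _ (f (val n)) (mem_set I)) => //.
by move=> x y _ _ [] /f_inj /val_inj.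
Qed.

Lemma denumerableP (L : language) (M : structure L) :
  denumerable M <-> countable [set: M] /\ infinite M.
Proof.
rewrite /denumerable card_eq_le /countable; split=> [/andP[->]|[->]].
  by move=> /infiniteP.
by move=> /infiniteP.
Qed.

(** * Skolem hulls *)

Fixpoint formula_code (L : language) (c : L -> nat) (phi : formula L) :
    GenTree.tree nat :=
  match phi with
  | Eq x y => GenTree.Node 0 [:: GenTree.Leaf x; GenTree.Leaf y]
  | Rel s t => GenTree.Node 1
      (GenTree.Leaf (c s) :: map (@GenTree.Leaf nat) t)
  | Bot => GenTree.Node 2 [::]
  | Imp p q => GenTree.Node 3 [:: formula_code c p; formula_code c q]
  | All x p => GenTree.Node 4 [:: GenTree.Leaf x; formula_code c p]
  end.

Lemma formula_code_inj (L : language) (c : L -> nat) :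
  injective c -> injective (formula_code c).
Proof.
move=> c_inj; elim=> [x y|s t||p IHp q IHq|x p IHp] [x' y'|s' t'||p' q'|x' p'] //=.
- by move=> [-> ->].
- move=> [/c_inj ss]; case: s' / ss t' => t' tt; congr Rel; apply: val_inj.
  by apply: inj_map tt => a b [].
- by move=> [/IHp-> /IHq->].
- by move=> [-> /IHp->].
Qed.

(** Leaves are the prescribed generators; a node labelled by the code of
    [All x phi] is a Skolem term for a counterexample, its subtrees giving the
    values of the first variables. *)
Fixpoint skolem_value (M : Type) (g : nat -> M) (w : nat -> seq M -> M)
    (t : GenTree.tree nat) : M :=
  match t with
  | GenTree.Leaf n => g n
  | GenTree.Node k ts => w k (map (skolem_value g w) ts)
  end.

(** Downward Loewenheim-Skolem.  Skolem terms are trees labelled by numbers, so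
    that the set of their values is countable by construction. *)
Lemma countable_elementary_hull (L : language) (M : structure L)
    (g : nat -> M) :
  countable [set: L] ->
  exists (N : structure L) (f : N -> M),
    [/\ countable [set: N], forall n, exists a, f a = g n &
        forall phi (e : nat -> N), sat e phi <-> sat (f \o e) phi].
Proof.
move=> /countable_inj[c c_inj].
pose k (x : nat) (phi : formula L) := pickle (x, formula_code c phi).
have k_inj x phi x' phi' : k x phi = k x' phi' -> x = x' /\ phi = phi'.
  by move=> /(pcan_inj pickleK)[-> /(formula_code_inj c_inj)->].
have /choice[w wP] : forall nl : nat * seq M, exists a0, forall x phi,
    nl.1 = k x phi -> (exists a, ~ sat (upd (nth (g 0) nl.2) x a) phi) ->
    ~ sat (upd (nth (g 0) nl.2) x a0) phi.
  move=> [n l] /=.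
  have [[x [phi [-> [a na]]]]|no] := pselect (exists x phi, n = k x phi /\
      exists a, ~ sat (upd (nth (g 0) l) x a) phi).
    by exists a => x' phi' /k_inj[<- <-].
  exists (g 0) => x phi nE [a na]; exfalso; apply: no.
  by exists x, phi; split=> //; exists a.
pose sk := skolem_value g (fun n l => w (n, l)).
pose inc : range sk -> M := val.
have inc_inj : injective inc by exact: val_inj.
pose N := Structure (fun (s : L) (t : (arity s).-tuple (range sk)) =>
  interp M s (map_tuple inc t)).
exists N, inc; split.
- have /choice[h hK] : forall x : N, exists t, sk t = inc x.
    by case=> x xP; have [t _ tx] := set_mem xP; exists t.
  apply/countable_inj; exists (pickle \o h); apply: inj_comp.
    exact: pcan_inj pickleK.
  by move=> x y xy; apply: inc_inj; rewrite -!hK xy.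
- move=> n; have gn : g n \in range sk by apply: mem_set; exists (GenTree.Leaf n).
  by exists (exist _ (g n) gn).
- apply: tarski_vaught => //.
  move=> e x phi b nb.
  have /choice[h hK] : forall y, exists t, sk t = inc (e y).
    move=> y; case: (e y) => z zP; have [t _ tz] := set_mem zP.
    by exists t.
  (* beyond the free variables of [phi] the environment is irrelevant *)
  pose m := (\max_(y <- free_vars phi) y).+1.
  pose ts := [seq h y | y <- iota 0 m].
  have E a y : y \in free_vars phi ->
      upd (nth (g 0) (map sk ts)) x a y = upd (inc \o e) x a y.
    move=> yphi; case: eqP => // _; rewrite [RHS]/= -hK /ts -map_comp.
    have ym : y < m by rewrite ltnS; apply: leq_bigmax_seq.
    by rewrite (nth_map 0) ?size_iota// nth_iota.
  pose a := w (k x phi, map sk ts).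
  have am : a \in range sk.
    by apply: mem_set; exists (GenTree.Node (k x phi) ts).
  exists (exist _ a am) => /= ha.
  apply: (wP (k x phi, map sk ts) x phi erefl).
    by exists b => /(iffLR (sat_eq_free (E b))).
  by apply: (iffRL (sat_eq_free (E a))).
Qed.

(** * Finite structures *)

Lemma inj_surj_bijective (T T' : Type) (f : T -> T') :
  injective f -> (forall y, exists x, f x = y) -> bijective f.
Proof.
move=> f_inj /choice[g gK]; exists g => // x.
by apply: f_inj; rewrite gK.
Qed.

Lemma finite_list (T : Type) :
  finite_set [set: T] <-> exists l : seq {classic T}, forall x : T, x \in l.
Proof.
split=> [/(@finite_seqP {classic T})[l lE]|[l lP]].
  by exists l => x; have : [set: T] x by []; rewrite lE.
apply/(@finite_seqP {classic T}); exists l.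
by apply/seteqP; split=> x //= _; apply: lP.
Qed.

(** One half of a back-and-forth, from an arbitrary structure into a finite one:
    if no value of the next variable worked, then each of the finitely many
    candidates would be excluded by a formula, and the disjunction of those would
    hold of every candidate but fail of the value to be matched. *)
Lemma finite_elementary_assignment (L : language) (X Y : structure L)
    (x0 : X) (eY : nat -> Y) (k : nat) :
  finite X -> model (Th X) Y ->
  exists eX : nat -> X, forall phi,
    (forall y, y \in free_vars phi -> y < k) -> sat eX phi <-> sat eY phi.
Proof.
move=> /finite_list[l lP] XY; elim: k => [|k [eX eXP]].
  exists (fun=> x0) => phi phi0; apply: model_Th_sat => //.
  by rewrite /sentence; case: (free_vars phi) phi0 => // y s /(_ y (mem_head _ _)).
apply: contrapT => no.
have /choice[F FP] : forall a : X, exists phi,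
    [/\ forall y, y \in free_vars phi -> y < k.+1,
        sat (upd eX k a) phi & ~ sat eY phi].
  move=> a; apply: contrapT => no'; apply: no; exists (upd eX k a) => phi phik.
  split=> h; apply: contrapT => nh; apply: no'.
    by exists phi.
  exists (Neg phi); split=> //= y.
  by rewrite cats0; apply: phik.
have H : sat eX (All k (BigOr (F : {classic X} -> _) l)).
  move=> a; apply/sat_BigOr; exists a => //.
  by have [] := FP a.
have /eXP H' : forall y, y \in free_vars (All k (BigOr (F : {classic X} -> _) l)) ->
    y < k.
  move=> y /=; rewrite mem_filter cats0 => /andP[yk /free_vars_BigAnd[a _]].
  rewrite /= cats0; have [/(_ y) h _ _] := FP a => /h.
  by rewrite ltnS leq_eqVlt (negbTE yk).
have /sat_ext := H'.1 H (eY k) => /(_ eY) h.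
have /h/sat_BigOr[a _ ha] : (fun y => if y == k then eY k else eY y) =1 eY.
  by move=> y; case: eqP => // ->.
by have [_ _] := FP a; apply.
Qed.

Lemma finite_model_isomorphic (L : language) (X Y : structure L) (x0 : X)
    (y0 : Y) :
  finite X -> model (Th X) Y -> isomorphic X Y.
Proof.
move=> Xfin XY.
have eqE k (eX : nat -> X) (eY : nat -> Y) : (forall phi,
    (forall y, y \in free_vars phi -> y < k) -> sat eX phi <-> sat eY phi) ->
  forall i j, i < k -> j < k -> eX i = eX j <-> eY i = eY j.
  move=> H i j ik jk; apply: (H (Eq i j)) => y.
  by rewrite !inE => /orP[/eqP->|/eqP->].
have [lX lXP] := iffLR (finite_list _) Xfin.
(* equalities transfer, so distinct elements of [Y] have distinct counterparts *)
have Yfin : finite Y.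
  apply: contrapT => /infinite_inj[eY eY_inj].
  have [eX eXP] := finite_elementary_assignment x0 eY (size lX).+1 Xfin XY.
  have := @uniq_leq_size {classic X} (map eX (iota 0 (size lX).+1)) lX.
  rewrite size_map size_iota ltnn => H.
  suff : false by []; apply: H => [|x _]; last exact: lXP.
  rewrite map_inj_in_uniq ?iota_uniq// => i j.
  rewrite !mem_iota /= => ik jk /(eqE _ _ _ eXP i j ik jk).
  exact: eY_inj.
have [l lP] := iffLR (finite_list _) Yfin.
pose eY : nat -> Y := nth (y0 : {classic Y}) l.
have [eX eXP] := finite_elementary_assignment x0 eY (size l) Xfin XY.
pose ix (y : Y) : nat := index (y : {classic Y}) l.
have ixl y : ix y < size l by rewrite index_mem.
have ixK y : eY (ix y) = y by apply: (@nth_index {classic Y}).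
apply: isomorphic_sym; exists (eX \o ix).
  apply: inj_surj_bijective => [y y' /= /(eqE _ _ _ eXP)|x].
    by rewrite !ixK; apply.
  pose psi := BigOr (fun j => @Eq L (size l) j) (iota 0 (size l)).
  have /eXP H : forall y, y \in free_vars (All (size l) psi) -> y < size l.
    move=> y /=; rewrite mem_filter cats0 => /andP[yk /free_vars_BigAnd[j]].
    rewrite mem_iota /= => jl.
    by rewrite !inE (negbTE yk) => /eqP ->.
  have HY : sat eY (All (size l) psi).
    move=> y; apply/sat_BigOr; exists (ix y); first by rewrite mem_iota /=.
    by rewrite /= eqxx ltn_eqF ?ixK.
  have /sat_BigOr[j] := iffRL H HY x.
  rewrite mem_iota /= eqxx => jl; rewrite ltn_eqF// => ->.
  exists (eY j); apply/(eqE _ _ _ eXP) => //.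
move=> s t; have /eXP : forall y,
    y \in free_vars (Rel s (map_tuple ix t)) -> y < size l.
  by move=> y /(@mapP {classic Y} nat ix t)[z _ ->].
rewrite /=.
have -> : map_tuple eY (map_tuple ix t) = t.
  by apply: val_inj; rewrite /= -map_comp (eq_map ixK) map_id.
have -> : map_tuple eX (map_tuple ix t) = map_tuple (eX \o ix) t.
  by apply: val_inj; rewrite /= -map_comp.
by move=> ->.
Qed.

Lemma model_Th_sym (L : language) (M N : structure L) (n0 : N) :
  model (Th M) N -> model (Th N) M.
Proof.
move=> MN phi [sphi h] e.
by apply/(model_Th_sat e (fun=> n0) MN sphi)/h.
Qed.

Lemma infinite_model (L : language) (M N : structure L) (m0 : M) (n0 : N) :
  infinite M -> model (Th M) N -> infinite N.
Proof.
move=> Minf MN Nfin; apply: Minf.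
have [f [g fK gK] _] := finite_model_isomorphic n0 m0 Nfin (model_Th_sym n0 MN).
have [l lP] := iffLR (finite_list _) Nfin.
apply/finite_list; exists (map f l) => x.
by rewrite -(gK x); apply: (@map_f {classic N} {classic M}).
Qed.

(** * Ultrapowers *)

(** In the ultrapower of [M] by a non-principal ultrafilter on the integers, the
    class [c] of the sequence [p] satisfies only the formulas satisfied by almost
    all of the [p m].  The elements of the ultrapower are encoded as canonical
    representatives of sequences modulo the ultrafilter. *)
Lemma limit_element (L : language) (M : structure L) (p : nat -> M) :
  exists (N : structure L) (c : N), model (Th M) N /\
    forall phi : formula L,
      (forall m m', sat (fun=> p m) phi -> sat (fun=> p m') phi -> m = m') ->
      ~ sat (fun=> c) phi.
Proof.
have [U [Uultra Uoo]] := @ultraFilterLemma nat \oo _.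
have Uprop : ProperFilter U by exact: ultra_proper.
pose rep (f : nat -> M) : nat -> M :=
  xget (p : {classic nat -> M}) [set g | \forall n \near U, g n = f n].
have repU f : \forall n \near U, rep f n = f n.
  apply: (@xgetPex {classic nat -> M} _ [set g | \forall n \near U, g n = f n]).
  by exists f; apply: nearW.
have repE f g : (\forall n \near U, f n = g n) -> rep f = rep g.
  move=> fg; rewrite /rep; suff -> : [set h | \forall n \near U, h n = f n]
    = [set h | \forall n \near U, h n = g n] by [].
  apply/seteqP.
  by split=> h /= hU; apply: filterS2 fg hU => n -> ->.
pose W := {f : nat -> M | rep f = f}.
pose cl f : W := exist _ (rep f) (repE _ _ (repU f)).
pose N := Structure (fun (s : L) (t : (arity s).-tuple W) =>
  \forall n \near U, interp M s (map_tuple (fun f : W => sval f n) t)).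
have los phi : forall e : nat -> N, sat e phi <->
    \forall n \near U, sat (fun y => sval (e y) n) phi.
  elim: phi => [x y|s t||q IHq r IHr|x q IHq] e /=.
  - split=> [->|]; first exact: nearW.
    case: (e x) (e y) => [f fE] [g gE] /= /repE fg.
    by apply: eq_exist; rewrite -fE -gE.
  - split; apply: filterS => n;
      (suff -> : map_tuple (fun f : W => sval f n) (map_tuple e t)
         = map_tuple (fun y => sval (e y) n) t by []);
      by apply: val_inj; rewrite /= -map_comp.
  - by split=> // /filter_ex[].
  - split=> [qr|qr /IHq hq]; last first.
      by apply/IHr; apply: filterS2 qr hq => n; apply.
    have [hq|hq] := in_ultra_setVsetC
        [set n | sat (fun y => sval (e y) n) q] Uultra.
      by have /IHr := qr (iffRL (IHq e) hq); apply: filterS.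
    by apply: filterS hq => n nq /nq.
  - split=> [h|h a].
      apply: contrapT => nh.
      have [//|{}nh] := in_ultra_setVsetC
        [set n | forall a, sat (upd (fun y => sval (e y) n) x a) q] Uultra.
      have /choice[f fP] : forall n, exists a,
          ~ (forall a, sat (upd (fun y => sval (e y) n) x a) q) ->
          ~ sat (upd (fun y => sval (e y) n) x a) q.
        move=> n; have [[a na]|no] := pselect (exists a,
            ~ sat (upd (fun y => sval (e y) n) x a) q); first by exists a.
        exists (p n) => nall; exfalso; apply: nall => a.
        by apply: contrapT => na; apply: no; exists a.
      have /IHq H := h (cl f).
      have /filter_ex[n] : \forall n \near U, False.
        apply: filterS3 H nh (repU f) => n + /fP + fn.
        by move=> + np; apply: contra_not np; apply: iffLR; apply: sat_ext => y;
          case: eqP.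
      by [].
    apply/IHq; apply: filterS h => n /(_ (sval a n)).
    by apply: iffLR; apply: sat_ext => y; case: eqP.
exists N, (cl p); split=> [phi [sphi Mphi] e|phi phi1 /los h].
  by apply/los; apply: nearW => n; apply: Mphi.
have /filter_ex[n] : \forall n \near U, False; last by [].
have {}h : \forall n \near U, sat (fun=> p n) phi.
  apply: filterS2 h (repU p) => n /=.
  by move=> + pn; apply: iffLR; apply: sat_ext => y; rewrite pn.
have [m hm] := filter_ex h.
have : \forall n \near U, (m < n)%N by apply: Uoo; exists m.+1.
apply: filterS2 h => n hn; rewrite (phi1 _ _ hm hn) ltnn.
by [].
Qed.

(** * The part of a structure on one of the predicates *)

Definition in_part (V : language) (I : Type) (Sigma : I -> set V)
    (M : structure (union_language Sigma)) (i : I) : set M :=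
  [set x | interp M (inr i : union_language Sigma) [tuple x]].
Arguments in_part {V I Sigma} M i x : rename.

Definition part (V : language) (I : Type) (Sigma : I -> set V)
    (M : structure (union_language Sigma)) (i : I) :
    structure (sublanguage (Sigma i)) :=
  @Structure (sublanguage (Sigma i)) (in_part M i)
    (fun s t => interp M (inl (bigcup_incl s) : union_language Sigma)
                  (map_tuple val t)).

Fixpoint relativize (V : language) (I : Type) (Sigma : I -> set V) (i : I)
    (phi : formula (sublanguage (Sigma i))) : formula (union_language Sigma) :=
  match phi with
  | Eq x y => Eq x y
  | Rel s t => @Rel (union_language Sigma) (inl (bigcup_incl s)) t
  | Bot => Bot
  | Imp p q => Imp (relativize p) (relativize q)
  | All x p => All x (Imp (@Rel (union_language Sigma) (inr i) [tuple x])
                          (relativize p))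
  end.

Lemma free_vars_relativize (V : language) (I : Type) (Sigma : I -> set V)
    (i : I) (phi : formula (sublanguage (Sigma i))) :
  free_vars (relativize phi) = free_vars phi.
Proof. by elim: phi => //= [p -> q ->|x p ->] //; rewrite eqxx. Qed.

Lemma sat_relativize (V : language) (I : Type) (Sigma : I -> set V)
    (M : structure (union_language Sigma)) (i : I)
    (phi : formula (sublanguage (Sigma i))) (e : nat -> part M i) :
  sat e phi <-> sat (fun y => val (e y) : M) (relativize phi).
Proof.
elim: phi e => [x y|s t||p IHp q IHq|x p IHp] e //=.
- by split=> [->|/val_inj].
- suff -> : map_tuple val (map_tuple e t) = map_tuple (fun y => val (e y) : M) t.
    by [].
  by apply: val_inj; rewrite /= -map_comp.
- by rewrite (IHp e) (IHq e).
- have E (b : M) : map_tuple (upd (fun y => val (e y) : M) x b) [tuple x]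
      = [tuple b] by apply: val_inj; rewrite /= eqxx.
  split=> [h b|h a].
    rewrite E => bi.
    have /IHp := h (exist _ b (mem_set bi)); apply: iffLR; apply: sat_ext => y.
    by case: eqP.
  apply/IHp; have := h (val a); rewrite E => /(_ (set_mem (valP a))).
  by apply: iffLR; apply: sat_ext => y; case: eqP.
Qed.

(** The part of a model of [Th M] is a model of the theory of the part of [M],
    by relativization. *)
Lemma model_part (V : language) (I : Type) (Sigma : I -> set V)
    (M N : structure (union_language Sigma)) (i : I) (m0 : part M i) :
  model (Th M) N -> model (Th (part M i)) (part N i).
Proof.
move=> MN phi [sphi h] e; apply/sat_relativize.
have srel : sentence (relativize phi).
  by rewrite /sentence free_vars_relativize.
apply/(model_Th_sat (fun=> val m0 : M) _ MN srel).
exact: (iffLR (sat_relativize phi (fun=> m0)) (h (fun=> m0))).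
Qed.

Lemma part_P_union (V : language) (I U : Type) (Sigma : I -> set V)
    (P : I -> set U)
    (A : forall i : I, interpretation (sublanguage (Sigma i)) (P i)) (i : I) :
  is_P_combination A -> isomorphic (Structure (A i)) (part (P_union A) i).
Proof.
move=> A_comb.
pose f (x : P i) : part (P_union A) i :=
  exist _ (bigcup_incl x) (mem_set (set_mem (valP x))).
pose g (y : part (P_union A) i) : P i :=
  exist _ (val (val y)) (mem_set (set_mem (valP y))).
exists f.
  by exists g => [x|y]; do ?apply: val_inj.
move=> s t; rewrite [interp (Structure _) s]/interp A_comb /=.
rewrite /P_union_restriction /=.
suff -> : map_tuple val (map_tuple f t) = map_tuple (@bigcup_incl I U P i) t.
  by [].
by apply: val_inj; rewrite /= -map_comp.
Qed.

(** * Relations do not cross the parts *)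

Lemma tuple_lift (T T' : Type) (g : T -> T') (n : nat) (t : n.-tuple T') :
  (forall k, exists a, g a = tnth t k) -> exists u, t = map_tuple g u.
Proof.
move=> /choice[h hK]; exists [tuple h k | k < n].
by apply: eq_from_tnth => k; rewrite tnth_map tnth_mktuple hK.
Qed.

Lemma map_tuple1 (T T' : Type) (g : T -> T') (t : 1.-tuple T) :
  map_tuple g t = [tuple g (thead t)].
Proof. by case/tupleP: t => x t; rewrite (tuple0 t); apply: val_inj. Qed.

(** The properties of a P-union with disjoint predicates that can be expressed
    one index at a time.  That a related tuple lies in a single part would be a
    disjunction over [I], perhaps an infinite one; its consequence for each [i]
    is first-order. *)
Definition parted (V : language) (I : Type) (Sigma : I -> set V)
    (M : structure (union_language Sigma)) : Prop :=
  (forall i j x, in_part M i x -> in_part M j x -> i = j) /\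
  (forall (s : set_type (\bigcup_i Sigma i)) (t : (arity (val s)).-tuple M) i,
     interp M (inl s : union_language Sigma) t ->
     (val s \in Sigma i /\ forall k, in_part M i (tnth t k)) \/
     (forall k, ~ in_part M i (tnth t k))).

Lemma parted_P_union (V : language) (I U : Type) (Sigma : I -> set V)
    (P : I -> set U)
    (A : forall i : I, interpretation (sublanguage (Sigma i)) (P i)) :
  trivIset [set: I] P -> parted (P_union A).
Proof.
move=> P_disj; split=> [i j x Pi Pj|s t i].
  by apply: P_disj => //; exists (val x).
move=> [j [sj [u [_ ->]]]].
have [ij|ij] := pselect (i = j).
  rewrite ij; left; split=> // k; rewrite tnth_map /in_part /=.
  exact: set_mem (valP (tnth u k)).
right => k; rewrite tnth_map /in_part /= => Pi; apply: ij.
apply: P_disj => //; exists (val (tnth u k)); split=> //.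
exact: set_mem (valP (tnth u k)).
Qed.

Definition InPart (V : language) (I : Type) (Sigma : I -> set V) (i : I)
    (x : nat) : formula (union_language Sigma) :=
  @Rel (union_language Sigma) (inr i) [tuple x].
Arguments InPart {V I} Sigma i x.

Lemma sat_InPart (V : language) (I : Type) (Sigma : I -> set V)
    (M : structure (union_language Sigma)) (e : nat -> M) (i : I) (x : nat) :
  sat e (InPart Sigma i x) = in_part M i (e x).
Proof. by rewrite /= (map_tuple1 e). Qed.

Lemma parted_model (V : language) (I : Type) (Sigma : I -> set V)
    (M N : structure (union_language Sigma)) :
  parted M -> model (Th M) N -> N -> parted N.
Proof.
move=> [M_disj M_loc] MN n0.
split=> [i j x|s t i].
  have [//|ij] := pselect (i = j).
  have E (K : structure (union_language Sigma)) (e : nat -> K) :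
      sat e (Imp (InPart Sigma i 0) (Neg (InPart Sigma j 0)))
      = (in_part K i (e 0) -> ~ in_part K j (e 0)) by rewrite -!sat_InPart.
  have : holds N (Imp (InPart Sigma i 0) (Neg (InPart Sigma j 0))).
    by apply: (model_Th_holds MN) => e; rewrite E => ei /(M_disj _ _ _ ei).
  by move=> /(_ (fun=> x)); rewrite E => h xi xj; case: (h xi xj).
pose n := arity (val s).
pose C := if val s \in Sigma i then BigAnd (fun k : 'I_n => InPart Sigma i k) (enum 'I_n)
  else Bot.
pose D := BigAnd (fun k : 'I_n => Neg (InPart Sigma i k)) (enum 'I_n).
pose phi := Imp (@Rel (union_language Sigma) (inl s) (iota_tuple n 0))
  (Imp (Neg C) D).
have satC (K : structure (union_language Sigma)) (e : nat -> K) :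
    sat e C <-> val s \in Sigma i /\ forall k : 'I_n, in_part K i (e k).
  rewrite /C; case: ifP => si; last by split=> // -[].
  split=> [/(@sat_BigAnd _ _ _ 'I_n) h|[_ h]].
    by split=> // k; rewrite -sat_InPart; apply: h; rewrite mem_enum.
  by apply/(@sat_BigAnd _ _ _ 'I_n) => k _; rewrite sat_InPart.
have satD (K : structure (union_language Sigma)) (e : nat -> K) :
    sat e D <-> forall k : 'I_n, ~ in_part K i (e k).
  split=> [/(@sat_BigAnd _ _ _ 'I_n) h k|h].
    by rewrite -sat_InPart; apply: (h k); rewrite mem_enum.
  by apply/(@sat_BigAnd _ _ _ 'I_n) => k _; have := h k; rewrite -sat_InPart.
have nth_iota_tuple (K : Type) (e : nat -> K) (k : 'I_n) :
    tnth (map_tuple e (iota_tuple n 0)) k = e k.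
  by rewrite tnth_map (tnth_nth 0) /= nth_iota.
have Nphi : holds N phi.
  apply: (model_Th_holds MN) => e st nC.
  have [[si h]|h] := M_loc _ _ i st.
    exfalso; apply: nC; apply/satC; split=> // k.
    by have := h k; rewrite nth_iota_tuple.
  by apply/satD => k; have := h k; rewrite nth_iota_tuple.
have tE : t = map_tuple (nth n0 t) (iota_tuple n 0).
  by apply: eq_from_tnth => k; rewrite nth_iota_tuple (tnth_nth n0).
move=> st; have := Nphi (nth n0 t); rewrite /phi /= -tE => /(_ st) h.
have [/satC[si hC]|/h /satD hD] := pselect (sat (nth n0 t) C); [left|right].
  by split=> // k; rewrite (tnth_nth n0).
by move=> k; rewrite (tnth_nth n0).
Qed.

(** * Replacing one part *)

(** [M] with its part on [i] replaced by [X].  The nullary relations of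
    [Sigma i] are read off from [X] only, as they are relations of that part. *)
Definition splice (V : language) (I : Type) (Sigma : I -> set V)
    (M : structure (union_language Sigma)) (i : I)
    (X : structure (sublanguage (Sigma i))) : structure (union_language Sigma) :=
  @Structure (union_language Sigma) (X + set_type (~` in_part M i))%type
    (fun s => match s return set ((arity (s : union_language Sigma)).-tuple _) with
     | inl s => [set t |
         (exists (si : val s \in Sigma i) (u : (arity (val s)).-tuple X),
            interp X (exist _ (val s) si : sublanguage (Sigma i)) u /\
            t = map_tuple inl u) \/
         ((val s \in Sigma i -> 0 < arity (val s)) /\
          exists u : (arity (val s)).-tuple (set_type (~` in_part M i)),
            interp M (inl s : union_language Sigma) (map_tuple val u) /\
            t = map_tuple inr u)]
     | inr j => [set t | match thead t with
                         | inl _ => j = i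
                         | inr r => in_part M j (val r)
                         end]
     end).

Lemma interp_bigcup_incl (V : language) (I : Type) (Sigma : I -> set V)
    (M : structure (union_language Sigma)) (i : I)
    (s : set_type (\bigcup_j Sigma j)) (si : val s \in Sigma i)
    (t : (arity (val s)).-tuple M) :
  interp M (inl (bigcup_incl (exist _ (val s) si : Sigma i))
            : union_language Sigma) t
  <-> interp M (inl s : union_language Sigma) t.
Proof.
case: s si t => v vi si t; rewrite /bigcup_incl.
by rewrite (bool_irrelevance (mem_set _) vi).
Qed.

Lemma splice_part (V : language) (I : Type) (Sigma : I -> set V)
    (M : structure (union_language Sigma)) (i : I) :
  parted M -> isomorphic (splice M (part M i)) M.
Proof.
move=> [M_disj M_loc].
pose f (z : splice M (part M i)) : M :=
  match z with inl x => val x | inr r => val r end.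
have inP (x : part M i) : in_part M i (val x) by exact: set_mem (valP x).
have notinP (r : set_type (~` in_part M i)) : ~ in_part M i (val r).
  exact: set_mem (valP r).
exists f.
  apply: inj_surj_bijective => [[x|r] [x'|r'] /= h|x].
  - by congr inl; apply: val_inj.
  - by case: (notinP r'); apply: (eq_ind _ _ (inP x) _ h).
  - by case: (notinP r); apply: (eq_ind _ _ (inP x') _ (esym h)).
  - by congr inr; apply: val_inj.
  - have [xi|xi] := pselect (in_part M i x).
      by exists (inl (exist _ x (mem_set xi))).
    by exists (inr (exist _ x (mem_set (xi : (~` in_part M i) x)))).
have inlE n (u : n.-tuple (part M i)) :
    map_tuple f (map_tuple inl u) = map_tuple val u.
  by apply: val_inj; rewrite /= -map_comp.
have inrE n (u : n.-tuple (set_type (~` in_part M i))) :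
    map_tuple f (map_tuple inr u) = map_tuple val u.
  by apply: val_inj; rewrite /= -map_comp.
case=> [s|j] t; last first.
  rewrite /= (map_tuple1 f t).
  case: (thead t) => [x|r] //=; split=> [->|]; first exact: inP.
  by move/M_disj; apply; apply: inP.
split.
  move=> [[si [u [Xu ->]]]|[_ [u [Mu ->]]]]; last by rewrite inrE.
  by rewrite inlE; apply: (iffLR (interp_bigcup_incl _ _) Xu).
move=> st; have [[si h]|h] := M_loc _ _ i st.
  have [u tE] : exists u, t = map_tuple (inl : part M i -> splice M (part M i)) u.
    apply: tuple_lift => k; have := h k; rewrite tnth_map.
    case: (tnth t k) => [x _|r]; first by exists x.
    by move/notinP.
  left; exists si, u; split=> //; apply: (iffRL (interp_bigcup_incl si _)).
  by move: st; rewrite tE inlE.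
(* a nullary relation of [Sigma i] belongs to the replaced part *)
have [/andP[si /eqP n0]|nn] := boolP ((val s \in Sigma i) && (arity (val s) == 0)).
  have k0 (k : 'I_(arity (val s))) : False by case: k => m; rewrite n0.
  have [u tE] : exists u, t = map_tuple (inl : part M i -> splice M (part M i)) u.
    by apply: tuple_lift => k.
  left; exists si, u; split=> //; apply: (iffRL (interp_bigcup_incl si _)).
  by move: st; rewrite tE inlE.
have [u tE] : exists u, t = map_tuple
    (inr : set_type (~` in_part M i) -> splice M (part M i)) u.
  apply: tuple_lift => k; have := h k; rewrite tnth_map.
  case: (tnth t k) => [x|r _]; last by exists r.
  by move/(_ (inP x)).
right; split; first by move=> si; move: nn; rewrite si lt0n.
by exists u; split=> //; move: st; rewrite tE inrE.
Qed.

(** [S] says which variables take values in the replaced part. *)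
Definition same_rest (V : language) (I : Type) (Sigma : I -> set V)
    (M : structure (union_language Sigma)) (i : I)
    (X Y : structure (sublanguage (Sigma i))) (S : nat -> bool)
    (e : nat -> splice M X) (e' : nat -> splice M Y) (eX : nat -> X)
    (eY : nat -> Y) : Prop :=
  forall y, if S y then e y = inl (eX y) /\ e' y = inl (eY y)
            else exists r, e y = inr r /\ e' y = inr r.

(** Feferman-Vaught reduction: when the values outside the replaced part are kept,
    the truth of [phi] depends only on the truth of finitely many formulas about
    the values inside.  A new element of the part is described by its finite
    pattern of true and false formulas, whose existence is a formula again; a new
    element outside is common to both structures.  The condition on free
    variables makes the reduction of a sentence consist of sentences. *)
Lemma splice_reduction (V : language) (I : Type) (Sigma : I -> set V)
    (M : structure (union_language Sigma)) (i : I)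
    (phi : formula (union_language Sigma)) (S : nat -> bool) :
  exists (T : finType) (Gamma : T -> formula (sublanguage (Sigma i))),
    (forall c y, y \in free_vars (Gamma c) -> y \in free_vars phi /\ S y) /\
    forall (X Y : structure (sublanguage (Sigma i))) (e : nat -> splice M X)
      (e' : nat -> splice M Y) eX eY,
      same_rest S e e' eX eY ->
      (forall c, sat eX (Gamma c) <-> sat eY (Gamma c)) ->
      sat e phi -> sat e' phi.
Proof.
elim: phi S => [x y|[s|j] t||p IHp q IHq|x p IHp] S.
- exists unit, (fun=> if S x && S y then Eq x y else Bot); split.
    move=> _ z; case: ifP => //= /andP[Sx Sy].
    by rewrite !inE => /orP[]/eqP->; rewrite eqxx ?orbT.
  move=> X Y e e' eX eY ee' /(_ tt) H /=.
  have := ee' x; have := ee' y; move: H.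
  case: (S x); case: (S y) => /=.
  + by move=> H [-> ->] [-> ->] [] /H ->.
  + by move=> _ [r [-> ->]] [-> ->].
  + by move=> _ [-> ->] [r [-> ->]].
  + by move=> _ [r [-> ->]] [r' [-> ->]] [->].
- have [/andP[si St]|nSt] := boolP ((val s \in Sigma i) && all S t).
    exists unit, (fun=> @Rel (sublanguage (Sigma i)) (exist _ (val s) si) t).
    split; first by move=> _ y yt; split=> //; apply: (allP St).
    move=> X Y e e' eX eY ee' /(_ tt) H /=.
    have eE : map_tuple e t = map_tuple inl (map_tuple eX t).
      apply: eq_from_tnth => k; rewrite !tnth_map.
      by have := ee' (tnth t k); rewrite (allP St) ?mem_tnth// => -[].
    have e'E : map_tuple e' t = map_tuple inl (map_tuple eY t).
      apply: eq_from_tnth => k; rewrite !tnth_map.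
      by have := ee' (tnth t k); rewrite (allP St) ?mem_tnth// => -[].
    rewrite eE e'E => -[[si' [u [Xu uE]]]|[n0 [u [Mu uE]]]].
      left; exists si, (map_tuple eY t); split=> //.
      apply/H; rewrite /= (bool_irrelevance si si').
      suff -> : map_tuple eX t = u by [].
      apply: eq_from_tnth => k.
      by have := congr1 (fun u => tnth u k) uE; rewrite !tnth_map => -[].
    have := congr1 (fun u => tnth u (Ordinal (n0 si))) uE.
    by rewrite !tnth_map.
  exists void, (fun=> Bot); split=> [[]//|X Y e e' eX eY ee' _ /=].
  move=> [[si [u [Xu uE]]]|[n0 [u [Mu uE]]]].
    case/negP: nSt; rewrite si; apply/allP => y /tnthP[k ->].
    have := congr1 (fun u => tnth u k) uE; rewrite !tnth_map.
    have := ee' (tnth t k); case: (S _) => // -[r [-> _]] //.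
  right; split=> //; exists u; split=> //.
  apply: eq_from_tnth => k.
  have := congr1 (fun u => tnth u k) uE; rewrite !tnth_map.
  have := ee' (tnth t k); case: (S _) => [[-> _]//|].
  by move=> [r [-> ->]] [->].
- exists void, (fun=> Bot); split=> [[]//|X Y e e' eX eY ee' _ /=].
  rewrite (map_tuple1 e) (map_tuple1 e') /=.
  have := ee' (thead t); case: (S _) => [[-> ->]//|].
  by move=> [r [-> ->]].
- by exists void, (fun=> Bot); split=> [[]|].
- have [T1 [G1 [fv1 H1]]] := IHp S; have [T2 [G2 [fv2 H2]]] := IHq S.
  exists (T1 + T2)%type, (fun c => match c with inl c => G1 c | inr c => G2 c end).
  split.
    by move=> [c|c] y => [/fv1|/fv2] /= []; rewrite mem_cat => ->; rewrite ?orbT.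
  move=> X Y e e' eX eY ee' H epq e'p.
  apply: (H2 _ _ _ _ _ _ ee' (fun c => H (inr c))); apply: epq.
  apply: (H1 _ _ e' e eY eX) => // [y|c]; last by split=> /(H (inl c)).
  have := ee' y; case: (S y) => [[]//|[r []]]; by exists r.
- have [T0 [G0 [fv0 H0]]] := IHp (upd S x false).
  have [T1 [G1 [fv1 H1]]] := IHp (upd S x true).
  (* the formulas of [G1] true and false of a new element of the part *)
  pose pat (c : {ffun T1 -> bool}) :=
    BigAnd (fun d => if c d then G1 d else Neg (G1 d)) (enum T1).
  exists (T0 + {ffun T1 -> bool})%type,
    (fun c => match c with inl c => G0 c | inr c => Ex x (pat c) end).
  split.
    move=> [c|c] y /=; rewrite mem_filter.
      by move=> /fv0[-> ]; case: (y == x).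
    rewrite !cats0 mem_filter => /andP[yx /free_vars_BigAnd[d _]].
    have -> : free_vars (if c d then G1 d else Neg (G1 d)) = free_vars (G1 d).
      by case: (c d); rewrite //= cats0.
    by rewrite yx => /fv1[->]; rewrite (negbTE yx).
  move=> X Y e e' eX eY ee' H exp [b|r].
    pose c := [ffun d => `[< sat (upd eY x b) (G1 d) >]].
    have satc (Z : structure (sublanguage (Sigma i))) (eZ : nat -> Z) :
        sat eZ (pat c) <-> forall d, sat (upd eY x b) (G1 d) <-> sat eZ (G1 d).
      split=> [/sat_BigAnd h d|h].
        have := h d; rewrite mem_enum ffunE => /(_ isT).
        by case: asboolP => u v; split=> // /v.
      by apply/sat_BigAnd => d _; rewrite ffunE; case: asboolP => /h.
    have hb : sat eY (Ex x (pat c)) by apply/sat_Ex; exists b; apply/satc.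
    have /sat_Ex[a /satc ha] := iffRL (H (inr c)) hb.
    apply: (H1 _ _ (upd e x (inl a)) _ (upd eX x a) (upd eY x b)) (exp (inl a)).
      by move=> y; case: (eqVneq y x) => // yx; apply: ee'.
    by move=> d; split=> /ha.
  apply: (H0 _ _ (upd e x (inr r)) _ eX eY) (exp (inr r)).
    by move=> y; case: (eqVneq y x) => [_|yx]; [exists r|apply: ee'].
  by move=> d; apply: (H (inl d)).
Qed.

Lemma splice_model (V : language) (I : Type) (Sigma : I -> set V)
    (M : structure (union_language Sigma)) (i : I)
    (X Y : structure (sublanguage (Sigma i))) (x0 : X) (y0 : Y) :
  model (Th X) Y -> model (Th (splice M X)) (splice M Y).
Proof.
move=> XY phi [sphi h].
have [T [G [fvG HG]]] := splice_reduction M i phi (fun=> true).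
apply: (@sentence_holds _ (splice M Y) _ (fun=> inl y0)) => //.
apply: (HG X Y (fun=> inl x0) _ (fun=> x0) (fun=> y0)) => // c.
apply: model_Th_sat => //; rewrite /sentence.
case: (free_vars (G c)) (fvG c) => // y s /(_ y (mem_head _ _))[].
by rewrite sphi.
Qed.

(** An isomorphism respects the predicate of the replaced part. *)
Lemma splice_isomorphic (V : language) (I : Type) (Sigma : I -> set V)
    (M : structure (union_language Sigma)) (i : I)
    (X Y : structure (sublanguage (Sigma i))) :
  isomorphic (splice M X) (splice M Y) -> isomorphic X Y.
Proof.
move=> [f [f' fK f'K] f_rel].
have notinP (r : set_type (~` in_part M i)) : ~ in_part M i (val r).
  exact: set_mem (valP r).
have f_inl x : exists y, f (inl x) = inl y.
  have [+ _] := f_rel (inr i) [tuple inl x].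
  rewrite (map_tuple1 f) /= => /(_ erefl).
  by case: (f (inl x)) => [y _|r /notinP//]; exists y.
have f'_inl y : exists x, f (inl x) = inl y.
  have [_ +] := f_rel (inr i) [tuple f' (inl y)].
  rewrite (map_tuple1 f) /= f'K => /(_ erefl).
  case E : (f' (inl y)) => [x|r] /= => [_|/notinP//].
  by exists x; rewrite -E f'K.
have [g gP] := choice f_inl.
have inl_inj (Z : structure (sublanguage (Sigma i))) n (u v : n.-tuple Z) :
    map_tuple (inl : Z -> splice M Z) u = map_tuple inl v -> u = v.
  move=> uv; apply: eq_from_tnth => k.
  by have := congr1 (fun u => tnth u k) uv; rewrite !tnth_map => -[].
have interp_inl (Z : structure (sublanguage (Sigma i)))
    (s : Sigma i) (u : (arity (val s)).-tuple Z) :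
    interp Z (s : sublanguage (Sigma i)) u <->
    interp (splice M Z) (inl (bigcup_incl s) : union_language Sigma)
      (map_tuple inl u).
  have E (v : (arity (val s)).-tuple Z) (si : val s \in Sigma i) :
      interp Z (exist _ (val s) si : sublanguage (Sigma i)) v <->
      interp Z (s : sublanguage (Sigma i)) v.
    by case: s u v si => v si _ t si'; rewrite /= (bool_irrelevance si' si).
  split=> [Zu|[[si [v [Zv uv]]]|[n0 [v [_ uv]]]]].
  - by left => /=; exists (valP s), u; split=> //; apply/E.
  - by rewrite (inl_inj _ _ _ _ uv); exact: (iffLR (E _ si) Zv).
  - have := congr1 (fun u => tnth u (Ordinal (n0 (valP s)))) uv.
    by rewrite !tnth_map.
exists g.
  apply: inj_surj_bijective => [x x' xx'|y].
    suff : inl x = inl x' :> splice M X by case.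
    by apply: (can_inj fK); rewrite !gP xx'.
  have [x xE] := f'_inl y; exists x.
  by have := gP x; rewrite xE => -[].
move=> s u; rewrite !interp_inl (f_rel (inl (bigcup_incl s))).
suff -> : map_tuple f (map_tuple inl u) = map_tuple inl (map_tuple g u) by [].
by apply: val_inj; rewrite /= -!map_comp; apply: eq_map => x /=; rewrite gP.
Qed.

(** * Gluing isomorphisms of the parts *)

Definition covered (V : language) (I : Type) (Sigma : I -> set V)
    (M : structure (union_language Sigma)) : Prop :=
  forall x : M, exists i, in_part M i x.

(** Finiteness of [I] turns the covering property into a formula. *)
Lemma covered_model (V : language) (I : Type) (Sigma : I -> set V)
    (M N : structure (union_language Sigma)) :
  finite_set [set: I] -> covered M -> model (Th M) N -> covered N.
Proof.
move=> /finite_list[l lP] M_cov MN x.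
have : holds N (@BigOr _ {classic I} (fun i => InPart Sigma i 0) l).
  apply: (model_Th_holds MN) => e; have [i ei] := M_cov (e 0).
  by apply/(@sat_BigOr _ _ _ {classic I}); exists i; rewrite ?sat_InPart.
move=> /(_ (fun=> x))/(@sat_BigOr _ _ _ {classic I})[i _].
by rewrite sat_InPart; exists i.
Qed.

Lemma glue_isomorphisms (V : language) (I : Type) (Sigma : I -> set V)
    (M N : structure (union_language Sigma)) :
  parted M -> covered M -> parted N -> covered N ->
  (forall i, isomorphic (part M i) (part N i)) -> isomorphic M N.
Proof.
move=> [M_disj M_loc] M_cov [N_disj N_loc] N_cov MN.
have F i := cid2 (MN i).
have [idx idxP] := choice M_cov.
pose f (x : M) : N := val (s2val (F (idx x)) (exist _ x (mem_set (idxP x)))).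
have fE i (y : part M i) : f (val y) = val (s2val (F i) y).
  have F_eq j k x (xj : x \in in_part M j) (xk : x \in in_part M k) : j = k ->
      val (s2val (F j) (exist _ x xj)) = val (s2val (F k) (exist _ x xk)).
    by move=> jk; case: k / jk xk => xk; rewrite (bool_irrelevance xj xk).
  case: y => x xi; apply: F_eq.
  by apply: M_disj (idxP _) _; apply: set_mem xi.
have f_part x : in_part N (idx x) (f x).
  exact: set_mem (valP (s2val (F (idx x)) _)).
(* a nonempty tuple lies in the part of its first entry, and the symbol of a
   nullary relation belongs to some [Sigma i] *)
have local (K : structure (union_language Sigma))
    (s : set_type (\bigcup_i Sigma i)) (t : (arity (val s)).-tuple K) :
    parted K -> covered K -> interp K (inl s : union_language Sigma) t ->
    exists i, val s \in Sigma i /\ forall k, in_part K i (tnth t k).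
  move=> [_ K_loc] K_cov st.
  have [n0|n0] := posnP (arity (val s)).
    have [i _ si] := set_mem (valP s); exists i; split; first exact: mem_set.
    by case=> k kn; exfalso; move: (kn); rewrite n0.
  have [i ti] := K_cov (tnth t (Ordinal n0)).
  by have [|/(_ (Ordinal n0))//] := K_loc _ _ i st; exists i.
exists f.
  apply: inj_surj_bijective => [x x' xx'|y].
    have ii : idx x' = idx x.
      by apply: N_disj (f_part x') _; rewrite -xx'.
    have x'i : in_part M (idx x) x' by rewrite -ii.
    have := fE _ (exist _ x' (mem_set x'i)); rewrite /= -xx' => /val_inj.
    have [g fK _] := s2valP (F (idx x)).
    by move=> /(can_inj fK) [].
  have [i yi] := N_cov y; have [g _ gK] := s2valP (F i).
  exists (val (g (exist _ y (mem_set yi)))).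
  by rewrite fE gK.
have key (s : set_type (\bigcup_i Sigma i)) i (u : (arity (val s)).-tuple (part M i)) :
    val s \in Sigma i ->
    interp M (inl s : union_language Sigma) (map_tuple val u) <->
    interp N (inl s : union_language Sigma) (map_tuple f (map_tuple val u)).
  move=> si.
  have -> : map_tuple f (map_tuple val u)
      = map_tuple val (map_tuple (s2val (F i)) u).
    by apply: eq_from_tnth => k; rewrite !tnth_map fE.
  rewrite -!(interp_bigcup_incl si).
  exact: (s2valP' (F i) (exist _ (val s) si)).
case=> [s|j] t; last first.
  move: (t : 1.-tuple M) => {t} /tupleP[x t]; rewrite (tuple0 t) map_tuple1.
  change (in_part M j x <-> in_part N j (f x)).
  split=> [xj|fxj]; first by rewrite -(M_disj _ _ _ (idxP x) xj).
  by rewrite -(N_disj _ _ _ (f_part x) fxj).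
split=> [st|st].
  have [i [si ti]] := local _ _ _ (conj M_disj M_loc) M_cov st.
  have [u tE] : exists u, t = map_tuple (val : part M i -> M) u.
    by apply: tuple_lift => k; exists (exist _ (tnth t k) (mem_set (ti k))).
  by move: st; rewrite tE; apply: (iffLR (key _ _ _ si)).
have [i [si ti]] := local _ _ _ (conj N_disj N_loc) N_cov st.
have [u tE] : exists u, t = map_tuple (val : part M i -> M) u.
  apply: tuple_lift => k; have := ti k; rewrite tnth_map.
  move=> /(N_disj _ _ _ (f_part _)) ii.
  have := idxP (tnth t k); rewrite ii => tk.
  by exists (exist _ (tnth t k) (mem_set tk)).
by move: st; rewrite tE; apply: (iffRL (key _ _ _ si)).
Qed.

(** * Countable models of the theory of a P-union *)

Lemma countable_sum (T T' : Type) :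
  countable [set: T] -> countable [set: T'] -> countable [set: T + T'].
Proof.
move=> /countable_inj[f f_inj] /countable_inj[g g_inj]; apply/countable_inj.
exists (fun z => match z with inl x => (f x).*2 | inr y => (g y).*2.+1 end).
case=> [x|x] [y|y] // h.
- by congr inl; apply/f_inj/double_inj.
- by have := congr1 odd h; rewrite /= !odd_double.
- by have := congr1 odd h; rewrite /= !odd_double.
- by congr inr; apply/g_inj/double_inj; case: h.
Qed.

Lemma countable_union_language (V : language) (I : Type) (Sigma : I -> set V) :
  countable [set: I] -> (forall i, countable (Sigma i)) ->
  countable [set: union_language Sigma].
Proof.
move=> Ic Sc; apply: countable_sum => //.
rewrite (eq_countable (card_setT _)).
by apply: bigcup_countable.
Qed.

Lemma elementary_model (L : language) (M N : structure L) (f : N -> M) :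
  (forall phi (e : nat -> N), sat e phi <-> sat (f \o e) phi) ->
  model (Th M) N.
Proof. by move=> f_el phi [_ h] e; apply/f_el. Qed.

Lemma denumerable_elementary_hull (L : language) (M : structure L) (m : M) :
  countable [set: L] -> infinite M ->
  exists (N : structure L) (f : N -> M),
    [/\ denumerable N, exists a, f a = m &
        forall phi (e : nat -> N), sat e phi <-> sat (f \o e) phi].
Proof.
move=> Lc Minf.
have [N [f [Nc /(_ 0)[a am] f_el]]] := countable_elementary_hull (fun=> m) Lc.
exists N, f; split=> //; last by exists a.
apply/denumerableP; split=> //.
exact: infinite_model m a Minf (elementary_model f_el).
Qed.

Lemma inhabited_part_model (V : language) (I : Type) (Sigma : I -> set V)
    (M N : structure (union_language Sigma)) (i : I) :
  part M i -> model (Th M) N -> N -> inhabited (part N i).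
Proof.
move=> m0 MN n0; have : holds N (Ex 0 (InPart Sigma i 0)).
  apply: (model_Th_holds MN) => e; apply/sat_Ex; exists (val m0).
  by rewrite sat_InPart; apply: set_mem (valP m0).
move=> /(_ (fun=> n0))/sat_Ex[a]; rewrite sat_InPart => ai.
exact: inhabits (exist _ a (mem_set ai)).
Qed.

(** Take a sequence with one entry in each of infinitely many parts.  At most one
    entry lies on a given predicate, so a limit element of the sequence lies on
    none, whereas the denumerable elementary hulls in [M] are covered. *)
Lemma omega_categorical_finite_index (V : language) (I : Type)
    (Sigma : I -> set V) (M : structure (union_language Sigma)) :
  countable [set: union_language Sigma] -> infinite M ->
  parted M -> covered M -> (forall i, exists x, in_part M i x) ->
  omega_categorical (Th M) -> finite_set [set: I].
Proof.
move=> Lc Minf [M_disj _] M_cov /choice[p pP] [_ cat].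
apply: contrapT => /infinite_inj[h h_inj].
have [K [c [MK c_lim]]] := limit_element (p \o h).
have c_out i : ~ in_part K i c.
  rewrite -(sat_InPart (fun=> c) i 0); apply: c_lim => m m'.
  rewrite !sat_InPart => mi m'i; apply: h_inj.
  by rewrite (M_disj _ _ _ (pP (h m)) mi) (M_disj _ _ _ (pP (h m')) m'i).
have Kinf : infinite K by apply: infinite_model (p (h 0)) c Minf MK.
have [N1 [f1 [N1d _ f1_el]]] := denumerable_elementary_hull (p (h 0)) Lc Minf.
have [N2 [f2 [N2d [d dc] f2_el]]] := denumerable_elementary_hull c Lc Kinf.
have [f [g _ gK] f_rel] : isomorphic N1 N2.
  apply: cat => //; first exact: elementary_model f1_el.
  exact: model_Th_trans MK (elementary_model f2_el).
have [i] := M_cov (f1 (g d)).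
rewrite -(sat_InPart (f1 \o fun=> g d) i 0) => /f1_el.
rewrite sat_InPart => gdi; apply: (c_out i).
rewrite -dc -(sat_InPart (f2 \o fun=> d) i 0); apply/f2_el.
rewrite sat_InPart; move: gdi => /(f_rel (inr i)).
by rewrite (map_tuple1 f) /= gK.
Qed.

(** The replaced part is recovered from the spliced structure, which has the
    same theory whichever model of the theory of the part is put in. *)
Lemma omega_categorical_part (V : language) (I : Type) (Sigma : I -> set V)
    (M : structure (union_language Sigma)) (i : I) :
  parted M -> infinite (part M i) -> omega_categorical (Th M) ->
  omega_categorical (Th (part M i)).
Proof.
move=> M_part Minf [[N MN Nd] cat].
have [Nc Ninf] := iffLR (denumerableP _) Nd.
have [hM _] := iffLR (infinite_inj _) Minf.
have [hN _] := iffLR (infinite_inj _) Ninf.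
have N_part : parted N := parted_model M_part MN (hN 0).
have partMN : model (Th (part M i)) (part N i) := model_part (hM 0) MN.
have [n0] : inhabited (part N i).
  exact: inhabited_part_model (hM 0) MN (hN 0).
split.
  exists (part N i) => //; apply/denumerableP; split.
    by apply: countable_preimage (@val_inj _ _ (set_type (in_part N i))) Nc.
  exact: infinite_model (hM 0) n0 Minf partMN.
have splice_ok (X : structure (sublanguage (Sigma i))) :
    model (Th (part M i)) X -> denumerable X ->
    model (Th M) (splice N X) /\ denumerable (splice N X).
  move=> MX /denumerableP[Xc Xinf].
  have [hX _] := iffLR (infinite_inj _) Xinf.
  have NX : model (Th M) (splice N X).
    apply: (model_Th_trans MN); apply: (@model_Th_trans _ _ (splice N (part N i))).
      exact/isomorphic_model/isomorphic_sym/splice_part.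
    apply: (splice_model n0 (hX 0)).
    exact: model_Th_trans (model_Th_sym n0 partMN) MX.
  split=> //; apply/denumerableP; split.
    apply: countable_sum => //.
    exact: countable_preimage (@val_inj _ _ (set_type (~` in_part N i))) Nc.
  apply/infinite_inj; have [g g_inj] := iffLR (infinite_inj _) Xinf.
  by exists (fun n => inl (g n)) => x y [] /g_inj.
move=> X Y /splice_ok HX /splice_ok HY /HX[X1 X2] /HY[Y1 Y2].
by apply: (@splice_isomorphic _ _ _ N); apply: cat.
Qed.

Theorem proposition2p1 (V : language) (I U : Type) (Sigma : I -> set V)
    (P : I -> set U)
    (A : forall i : I, interpretation (sublanguage (Sigma i)) (P i))
    (P_nonempty : forall i : I, P i !=set0)
    (A_comb : is_P_combination A)
    (P_disjoint : trivIset [set: I] P)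
    (Sigma_countable : forall i : I, countable (Sigma i))
    (I_countable : countable [set: I])
    (AP_infinite : infinite (P_union A)) :
  omega_categorical (Th (P_union A)) <->
  (finite_set [set: I] /\
   forall i : I, finite (Structure (A i)) \/
                 omega_categorical_structure (Structure (A i))).
Proof.
have Lc := countable_union_language I_countable Sigma_countable.
have A_part := parted_P_union A P_disjoint.
have A_cov : covered (P_union A) by case=> x xP; have [i _ xi] := set_mem xP; exists i.
have Ai i : isomorphic (Structure (A i)) (part (P_union A) i) := part_P_union i A_comb.
have a0 i : P i.
  by have [x xi] := cid (P_nonempty i); apply: exist _ x (mem_set xi).
have a0' i : part (P_union A) i by have [f _ _] := cid2 (Ai i); exact: f (a0 i).
split=> [cat|[Ifin Afin]].
  split.
    apply: omega_categorical_finite_index Lc AP_infinite A_part A_cov _ cat => i.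
    by exists (val (a0' i)); apply: set_mem (valP (a0' i)).
  move=> i; have [|Ainf] := pselect (finite (Structure (A i))); [by left|right].
  split=> //.
  have pinf : infinite (part (P_union A) i).
    exact: @infinite_model _ (Structure (A i)) _ (a0 i) (a0' i) Ainf (isomorphic_model (Ai i)).
  suff -> : Th (Structure (A i)) = Th (part (P_union A) i).
    exact: omega_categorical_part.
  apply/seteqP; split=> phi [sphi h]; split=> //; exact/(isomorphic_holds _ (Ai i)).
have [x0 _] := iffLR (infinite_inj _) AP_infinite.
split.
  have [N [f [Nd _ f_el]]] := denumerable_elementary_hull (x0 0) Lc AP_infinite.
  by exists N => //; apply: elementary_model f_el.
have part_ok (M : structure (union_language Sigma)) i :
    model (Th (P_union A)) M -> denumerable M ->
    [/\ model (Th (Structure (A i))) (part M i), inhabited (part M i) &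
        infinite (Structure (A i)) -> denumerable (part M i)].
  move=> AM /denumerableP[Mc Minf].
  have [hM _] := iffLR (infinite_inj _) Minf.
  have AiM : model (Th (Structure (A i))) (part M i).
    apply: model_Th_trans (isomorphic_model (Ai i)) _.
    exact: model_part (a0' i) AM.
  have [m0] : inhabited (part M i).
    exact: (inhabited_part_model (a0' i) AM (hM 0)).
  split=> // Ainf; apply/denumerableP; split.
    exact: countable_preimage (@val_inj _ _ (set_type (in_part M i))) Mc.
  exact: @infinite_model _ (Structure (A i)) _ (a0 i) m0 Ainf AiM.
move=> M N AM AN Md Nd.
have inh K : denumerable K -> inhabited (K : structure (union_language Sigma)).
  by move=> /denumerableP[_ /infinite_inj[h _]]; exists; exact: h 0.
have [m] := inh _ Md; have [n] := inh _ Nd.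
apply: glue_isomorphisms.
- exact: parted_model A_part AM m.
- exact: covered_model Ifin A_cov AM.
- exact: parted_model A_part AN n.
- exact: covered_model Ifin A_cov AN.
move=> i; have [AiM [mi] Mid] := part_ok M i AM Md.
have [AiN [ni] Nid] := part_ok N i AN Nd.
have [Ai_fin|[Ainf [_ cat]]] := Afin i.
  apply: (isomorphic_trans (N := Structure (A i))).
    exact/isomorphic_sym/(@finite_model_isomorphic _ (Structure (A i)) _ (a0 i) mi).
  exact: (@finite_model_isomorphic _ (Structure (A i)) _ (a0 i) ni).
by apply: cat => //; [apply: Mid|apply: Nid].
Qed.
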